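(* Let $L$ be a bounded linear operator on a complex Banach space $(\mathfrak{B},\|\cdot\|)$. Assume that there exist $h_0\in\mathfrak{B}$, $\Lambda>0$ and a sequence of linear functionals $\{\ell_k\}_{k=1}^\infty\subset\mathfrak{B}^*$ satisfying the following: (B-1) $\limsup_{k\to\infty}\|\ell_k\|^{1/k}\le\Lambda^{-1}$; (B-2) $\ell_1(h_0)=1$ and, for all integers $k\ge1$, $\ell_{k+1}(h_0)=0$; (B-3) for all integers $k\ge1$, $L^*\ell_{k+1}=\ell_k$. Then the essential spectral radius of $L:\mathfrak{B}\to\mathfrak{B}$ is at least $\Lambda$.
   Context: $\mathfrak{B}^*$ is the dual of $\mathfrak{B}$, with norm $\|\ell\|=\sup\{|\ell(h)|:h\in\mathfrak{B},\|h\|\le1\}$, and $L^*$ is the dual operator $(L^*\ell)(h)=\ell(Lh)$. *)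

(* Defs.v *)
From HB Require Import structures.
From mathcomp Require Import all_boot all_order all_algebra.
From mathcomp Require Import complex.
From mathcomp Require Import all_classical all_reals all_analysis.

Set Implicit Arguments.
Unset Strict Implicit.
Unset Printing Implicit Defensive.

Import Order.TTheory GRing.Theory Num.Theory.
Import numFieldNormedType.Exports.

Local Open Scope classical_set_scope.
Local Open Scope ring_scope.

(* [R[i]^o] is the complex line as a normed module over itself.  Norms of
   normed modules over [R[i]] take values in [R[i]] (they are real and
   nonnegative there); [complex.Re] brings them back to [R]. *)

Definition bounded_linear_map (R : realType) (V W : normedModType R[i])
    (f : {linear V -> W}) : Prop :=
  bounded_near f (nbhs (0 : V)).

Definition dual_norm (R : realType) (V : normedModType R[i])
    (l : {linear V -> R[i]^o}) : R :=
  sup [set complex.Re `|l h| | h in [set h : V | `|h| <= 1]].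

Definition dual_operator (R : realType) (V : normedModType R[i])
    (L : {linear V -> V}) (l : {linear V -> R[i]^o}) : {linear V -> R[i]^o} :=
  l \o L.

Definition shift_operator (R : realType) (V : normedModType R[i])
    (L : {linear V -> V}) (z : R[i]) (h : V) : V :=
  z *: h - L h.

Definition resolvent_set (R : realType) (V : normedModType R[i])
    (L : {linear V -> V}) : set R[i]^o :=
  [set z | exists S : {linear V -> V}, bounded_linear_map S /\
     cancel (shift_operator L z) S /\ cancel S (shift_operator L z)].

Definition spectrum (R : realType) (V : normedModType R[i])
    (L : {linear V -> V}) : set R[i]^o :=
  ~` resolvent_set L.

Definition generalized_kernel (R : realType) (V : normedModType R[i])
    (L : {linear V -> V}) (z : R[i]) : set V :=
  [set h | exists n : nat, iter n (shift_operator L z) h = 0].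

(* For a linear subspace [A], this says that [A] is finite dimensional. *)
Definition in_finite_span (R : realType) (V : normedModType R[i])
    (A : set V) : Prop :=
  exists (n : nat) (e : 'I_n -> V), forall h, A h ->
    exists c : 'I_n -> R[i], h = \sum_(i < n) c i *: e i.

(* Browder's essential spectrum: its complement in the spectrum consists of the
   isolated eigenvalues of finite algebraic multiplicity.  Without the
   closed-range clause a point such as 0, for a compact injective quasinilpotent
   operator, would wrongly be left out.  The Fredholm, Weyl and Browder essential
   spectra and the Calkin algebra all give the same essential spectral radius. *)
Definition essential_spectrum (R : realType) (V : normedModType R[i])
    (L : {linear V -> V}) : set R[i]^o :=
  [set z | spectrum L z /\
     (~ closed (range (shift_operator L z)) \/
      ~ in_finite_span (generalized_kernel L z) \/
      limit_point (spectrum L) z)].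

(* The supremum is taken in the extended reals, so that it is [-oo], and not an
   arbitrary real, when the essential spectrum is empty. *)
Definition essential_spectral_radius (R : realType) (V : normedModType R[i])
    (L : {linear V -> V}) : \bar R :=
  ereal_sup [set (complex.Re `|z|)%:E | z in essential_spectrum L].

(* Main.v *)
(* Let N_j be the common kernel of the l_k with k >= j, so that L maps N_1 into
   N_2.  Call z good if every x with (z - L) x in N_2 lies in N_1.  If |z| is
   less than Lambda, then z is good: on such an x one has
   l_k x = z^n l_(k+n) x, which tends to 0 by (B-1).  A resolvent point z of
   large modulus is not good, because h0 is in N_2, x = (z - L)^-1 h0 is small,
   and x in N_1 would give l_1 (L x) = - l_1 h0 = -1.  Goodness is locally
   constant on the resolvent set, since the resolvent at w near z is obtained by
   iterating a contraction that preserves N_1 whenever z is good.  Hence every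
   horizontal segment running from the disc of radius Lambda far to the right
   meets the spectrum.  Letting the height of the segment tend to 0 produces a
   limit point of the spectrum of modulus at least r, for every r < Lambda. *)

Require Import Defs.
From HB Require Import structures.
From mathcomp Require Import all_boot all_order all_algebra.
From mathcomp Require Import complex.
From mathcomp Require Import all_classical all_reals all_analysis.
From mathcomp Require Import lra ring.

Set Implicit Arguments.
Unset Strict Implicit.
Unset Printing Implicit Defensive.

Import Order.TTheory GRing.Theory Num.Theory.
Import numFieldNormedType.Exports.

Local Open Scope classical_set_scope.
Local Open Scope ring_scope.

(** * Real-valued norms and bounded linear maps *)

(** Estimates are carried out in [R], where the order is total; the order of [R[i]] is only
    partial. *)
Definition rnorm (R : realType) (V : normedZmodType R[i]) (x : V) : R :=
  complex.Re `|x|.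

Section RealNorm.
Context {R : realType}.
Implicit Types (V W : normedModType R[i]).

Lemma rnormE (V : normedZmodType R[i]) (x : V) :
  `|x| = real_complex R (rnorm x).
Proof. by rewrite /rnorm RRe_real // normr_real. Qed.

Lemma rnorm_ge0 (V : normedZmodType R[i]) (x : V) : 0 <= rnorm x.
Proof. by rewrite -ler0c -rnormE normr_ge0. Qed.

Lemma ler_rnormD (V : normedZmodType R[i]) (x y : V) :
  rnorm (x + y) <= rnorm x + rnorm y.
Proof. by rewrite -lecR rmorphD /= -!rnormE ler_normD. Qed.

Lemma rnormN (V : normedZmodType R[i]) (x : V) : rnorm (- x) = rnorm x.
Proof. by rewrite /rnorm normrN. Qed.

Lemma rnorm0 (V : normedZmodType R[i]) : rnorm (0 : V) = 0.
Proof. by rewrite /rnorm normr0. Qed.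

Lemma rnorm_eq0 (V : normedZmodType R[i]) (x : V) : rnorm x <= 0 -> x = 0.
Proof.
move=> x0; apply/eqP; rewrite -normr_le0 rnormE.
by rewrite -(rmorph0 (real_complex R)) lecR.
Qed.

Lemma rnormZ V (a : R[i]) (x : V) : rnorm (a *: x) = rnorm a * rnorm x.
Proof.
by apply: complexI; rewrite rmorphM /= -!rnormE normrZ.
Qed.

Lemma rnormM (a b : R[i]) : rnorm (a * b) = rnorm a * rnorm b.
Proof.
by apply: complexI; rewrite rmorphM /= -!rnormE normrM.
Qed.

Lemma rnormX (a : R[i]) n : rnorm (a ^+ n) = rnorm a ^+ n.
Proof.
by apply: complexI; rewrite rmorphXn /= -!rnormE normrX.
Qed.

Lemma rnorm_real (a : R) : rnorm (real_complex R a) = `|a|.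
Proof. by rewrite /rnorm normc_def /= expr0n addr0 sqrtr_sqr. Qed.

Lemma bounded_linear_mapP V W (f : {linear V -> W}) :
  bounded_linear_map f <->
  exists2 K : R, 0 < K & forall x, rnorm (f x) <= K * rnorm x.
Proof.
rewrite /bounded_linear_map linear_boundedP; split.
  case=> M [Mr] fM.
  (* Every real above [M] is an admissible constant; this one is also positive. *)
  have M0 : M < real_complex R (`|complex.Re M| + 1).
    rewrite -[M in X in X < _]RRe_real // ltcR.
    by rewrite ltr_pwDr // ler_norm.
  exists (`|complex.Re M| + 1); first by rewrite ltr_pwDr.
  by move=> x; have := fM _ M0 x; rewrite !rnormE -rmorphM /= lecR.
case=> K K0 fK; exists (real_complex R K); split.
  by apply/complex_realP; exists K.
move=> r Kr x; apply: (@le_trans _ _ (real_complex R K * `|x|)).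
  by rewrite !rnormE -rmorphM /= lecR.
by rewrite ler_wpM2r // ltW.
Qed.

(** Together with [rnorm_eq0], this is how vectors and values of functionals are shown to vanish. *)
Lemma le0_geometric (a C q : R) : 0 <= q -> q < 1 ->
  (forall n : nat, a <= C * q ^+ n) -> a <= 0.
Proof.
move=> q0 q1 aC.
have Cq : (fun n : nat => C * q ^+ n) @ \oo --> (C * 0 : R).
  by apply: cvgMr; apply: cvg_expr; rewrite ger0_norm.
rewrite mulr0 in Cq.
by apply: (cvgr_to_ge Cq); exact: nearW.
Qed.

End RealNorm.

(** * Geometric convergence and fixed points of contractions *)

Section HalfContraction.
Context {R : realType}.

Lemma iter_half_contraction (V : normedModType R[i]) (T : V -> V) (p : V) :
  (forall x, rnorm (T x - p) <= 2^-1 * rnorm (x - p)) ->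
  forall x n, rnorm (iter n T x - p) <= rnorm (x - p) * 2^-1 ^+ n.
Proof.
move=> Tp x; elim=> [|n IH]; first by rewrite expr0 mulr1.
by rewrite iterS (le_trans (Tp _)) // exprS mulrCA ler_wpM2l.
Qed.

Lemma geometric_cvg (V : completeNormedModType R[i]) (u : nat -> V) (C : R) :
  (forall n, rnorm (u n.+1 - u n) <= C * 2^-1 ^+ n) ->
  exists p, forall n, rnorm (u n - p) <= C * 2 * 2^-1 ^+ n.
Proof.
move=> uC.
have C0 : 0 <= C.
  by have := le_trans (rnorm_ge0 _) (uC 0%N); rewrite expr0 mulr1.
have pow0 n : 0 <= (2^-1 : R) ^+ n by rewrite exprn_ge0.
(* The difference of powers is the exact value of the summed bounds, so the induction on [m] closes;
   the bound without it would not. *)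
have um n m : rnorm (u (n + m)%N - u n)
    <= C * 2 * (2^-1 ^+ n - 2^-1 ^+ (n + m)%N).
  elim: m => [|m IH]; first by rewrite addn0 !subrr mulr0 rnorm0.
  rewrite addnS -(subrKA (u (n + m)%N)) (le_trans (ler_rnormD _ _)) //.
  rewrite (le_trans (lerD (uC _) IH)) // exprS.
  by rewrite le_eqVlt; apply/orP; left; apply/eqP; field.
have um' n m : rnorm (u (n + m)%N - u n) <= C * 2 * 2^-1 ^+ n.
  by rewrite (le_trans (um n m)) // ler_wpM2l ?mulr_ge0 // gerBl.
have pow_cvg : (fun n => C * 2 * (2^-1 : R) ^+ n) @ \oo --> (0 : R).
  rewrite -[X in _ --> X](mulr0 (C * 2)); apply: cvgMr; apply: cvg_expr.
  by rewrite ger0_norm // invf_lt1 // ltr1n.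
have : cvg (u @ \oo).
  apply/cauchy_cvgP/cauchy_exP => e e0.
  (* The radius [e] lives in [R[i]]; being positive, it is real. *)
  have eE : e = real_complex R (complex.Re e) by rewrite RRe_real // gtr0_real.
  have e0' : 0 < complex.Re e by rewrite -ltcR -eE.
  have /cvgrPdist_lt/(_ _ e0')[N _ /(_ N (leqnn N)) /=] := pow_cvg.
  rewrite sub0r normrN ger0_norm ?mulr_ge0 // => Ne.
  exists (u N); exists N => // n /= Nn.
  rewrite -ball_normE /= distrC rnormE eE ltcR (le_lt_trans _ Ne) //.
  by rewrite -(subnKC Nn) um'.
move=> /cvg_ex[p up]; exists p => n.
apply/ler_addgt0Pr => e e0.
have e0C : 0 < real_complex R e by rewrite ltcR.
have /cvgrPdist_lt/(_ _ e0C)[N _ Ne] := up.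
have := Ne (n + N)%N (leq_addl _ _).
rewrite /= rnormE ltcR => upN.
rewrite -[_ - p](subrKA (u (n + N)%N)) (le_trans (ler_rnormD _ _)) // lerD //.
  by rewrite -rnormN opprB um'.
by rewrite -rnormN opprB ltW.
Qed.

(** Banach's fixed-point theorem with ratio one half: the iterates from [0] converge to some [p],
    and both [p] and [T p] are geometrically close to them. *)
Lemma half_contraction_fixpoint (V : completeNormedModType R[i])
    (T : V -> V) :
  (forall x y, rnorm (T x - T y) <= 2^-1 * rnorm (x - y)) ->
  exists p, T p = p.
Proof.
move=> Tc.
have [|p up] := @geometric_cvg V (fun n => iter n T 0) (rnorm (T 0 - 0)).
  elim=> [|n IH]; first by rewrite expr0 mulr1.
  by rewrite iterS (le_trans (Tc _ _)) // exprS mulrCA ler_wpM2l.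
exists p; apply/eqP; rewrite -subr_eq0; apply/eqP/rnorm_eq0.
have half_lt1 : 2^-1 < 1 :> R by rewrite invf_lt1 // ltr1n.
apply: (@le0_geometric _ _ (rnorm (T 0 - 0) * 2) 2^-1) => // n.
rewrite -(subrKA (iter n.+1 T 0)) (le_trans (ler_rnormD _ _)) //.
have h1 : rnorm (T p - iter n.+1 T 0) <= 2^-1 * rnorm (iter n T 0 - p).
  by rewrite -[in leRHS]rnormN opprB iterS Tc.
have /= := up n; have /= := up n.+1; rewrite exprS /= in h1 *; lra.
Qed.

End HalfContraction.

(** * The resolvent set and its openness *)

Section Resolvent.
Context {R : realType}.

(** [K] bounds the norm of the inverse of [z - L], without carrying that inverse as a bundled linear
    map. *)
Definition resolvent_bound (V : normedModType R[i]) (L : {linear V -> V})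
    (z : R[i]) (K : R) : Prop :=
  [/\ 0 < K,
      forall x, rnorm x <= K * rnorm (shift_operator L z x) &
      forall f, exists x, shift_operator L z x = f].

Lemma shift_operator_linear (V : normedModType R[i]) (L : {linear V -> V}) z :
  linear (shift_operator L z).
Proof.
move=> a x y; rewrite /shift_operator linearP scalerBr scalerDr !scalerA.
by rewrite [a * z]mulrC opprD addrACA.
Qed.

HB.instance Definition _ (V : normedModType R[i]) (L : {linear V -> V}) z :=
  GRing.isLinear.Build _ _ _ _ (shift_operator L z) (shift_operator_linear L z).

Lemma shift_operator_perturb (V : normedModType R[i]) (L : {linear V -> V})
    z w x :
  shift_operator L z x = shift_operator L w x + (z - w) *: x.
Proof.
by rewrite /shift_operator scalerBl [RHS]addrC addrA subrK. Qed.

(** Conversely, a choice [S] of preimages is linear because [z - L] is linear and injective, and the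
    lower bound on [z - L] makes [S] bounded. *)
Lemma resolvent_setP (V : normedModType R[i]) (L : {linear V -> V}) z :
  resolvent_set L z <-> exists K, resolvent_bound L z K.
Proof.
split=> [[S [/bounded_linear_mapP[K K0 SK] [shiftK SK']]]|].
  exists K; split=> // [x|f]; last by exists (S f); rewrite SK'.
  by rewrite -[in leLHS](shiftK x).
case=> K [K0 zK /choice[S SK]].
have inj : injective (shift_operator L z).
  move=> x y xy; apply/eqP; rewrite -subr_eq0; apply/eqP/rnorm_eq0.
  by rewrite (le_trans (zK _)) // linearB /= xy subrr rnorm0 mulr0.
have Slin : linear S.
  by move=> a x y; apply: inj; rewrite linearP /= !SK.
pose SL := GRing.isLinear.Build _ _ _ _ S Slin.
pose SP : {linear V -> V} := HB.pack S SL.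
exists SP; split; last by split=> x /=; [apply: inj |]; rewrite SK.
by apply/bounded_linear_mapP; exists K => // x; rewrite -{2}(SK x) zK.
Qed.

(** The term [(z - w) *: x] costs at most half of [rnorm x], which is absorbed on the left and
    doubles [K]. Solving [(w - L) x = f] amounts to finding a fixed point of
    [x |-> S (f + (z - w) *: x)], where [S] inverts [z - L]. *)
Lemma resolvent_bound_perturb (V : completeNormedModType R[i])
    (L : {linear V -> V}) z w K :
  resolvent_bound L z K -> K * rnorm (z - w) <= 2^-1 ->
  resolvent_bound L w (2 * K).
Proof.
move=> [K0 zK zS] Kzw; split=> [|x|f]; first by rewrite mulr_gt0.
  have := zK x; rewrite (shift_operator_perturb _ _ w).
  set s := shift_operator L w x => xK.
  have := ler_wpM2l (ltW K0) (ler_rnormD s ((z - w) *: x)).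
  have := ler_wpM2r (rnorm_ge0 x) Kzw.
  rewrite rnormZ mulrDr; lra.
have [S SK] := choice zS.
have [|p pE] := @half_contraction_fixpoint _ V (fun x => S (f + (z - w) *: x)).
  move=> x y; rewrite (le_trans (zK _)) // linearB /= !SK.
  rewrite opprD addrACA subrr add0r -scalerBr rnormZ mulrA.
  by rewrite ler_wpM2r ?rnorm_ge0.
exists p; have := SK (f + (z - w) *: p); rewrite pE.
by rewrite (shift_operator_perturb _ _ w) => /addIr.
Qed.

Lemma resolvent_set_nbhs (V : completeNormedModType R[i])
    (L : {linear V -> V}) z K :
  resolvent_bound L z K ->
  forall w, rnorm (z - w) <= (2 * K)^-1 -> resolvent_set L w.
Proof.
move=> zK w zw; apply/resolvent_setP; exists (2 * K).
apply: (resolvent_bound_perturb zK).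
have K0 : 0 < K by case: zK.
by rewrite -ler_pdivlMl // -invfM mulrC.
Qed.

End Resolvent.

(** * The backward orbit of functionals and the subspaces it annihilates *)

Section BackwardOrbit.
Context {R : realType} (B : completeNormedModType R[i]).
Context (L : {linear B -> B}).
Context (l : nat -> {linear B -> R[i]^o}).
Context (l_bounded :
  forall k : nat, (1 <= k)%N -> bounded_linear_map (l k)).
Context (l_backward :
  forall k : nat, (1 <= k)%N -> dual_operator L (l k.+1) =1 l k).

(** The space [N_j] of the overview. *)
Definition annihilated_from (j : nat) : set B :=
  [set x | forall k, (j <= k)%N -> l k x = 0].

(** Goodness of [z] in the overview. Phrased without an inverse, it also makes sense at spectral
    points. *)
Definition resolvent_preserves (z : R[i]) : Prop :=
  forall x, annihilated_from 2 (shift_operator L z x) -> annihilated_from 1 x.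

Lemma annihilated_from_add j a x y :
  annihilated_from j x -> annihilated_from j y ->
  annihilated_from j (x + a *: y).
Proof.
by move=> xj yj k jk; rewrite linearD linearZ /= xj // yj // scaler0 addr0.
Qed.

Lemma backward_shift_operator z x k : (1 <= k)%N ->
  l k.+1 (shift_operator L z x) = z * l k.+1 x - l k x.
Proof. by move=> k1; rewrite linearB linearZ -(l_backward k1). Qed.

Lemma small_resolvent_preserves (q : R) (z : R[i]) :
  0 < q -> rnorm z < q ->
  (exists N, forall k, (N <= k)%N -> forall x,
    rnorm (l k x) <= (q ^+ k)^-1 * rnorm x) ->
  resolvent_preserves z.
Proof.
move=> q0 zq [N lN] x xN k k1.
have iterE n : l k x = z ^+ n * l (k + n)%N x.
  elim: n => [|n ->]; first by rewrite expr0 mul1r addn0.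
  rewrite addnS exprSr -mulrA; congr (_ * _); apply/esym/eqP; rewrite -subr_eq0.
  rewrite -backward_shift_operator; last by rewrite (leq_trans k1) ?leq_addr.
  by rewrite xN // ltnS (leq_trans k1) ?leq_addr.
apply: rnorm_eq0.
(* The expansion is used at index [k + (N + n)], beyond [N] for every [n]; the constant collects the
   factors independent of [n]. *)
apply: (@le0_geometric _ _ ((q ^+ (k + N))^-1 * rnorm z ^+ N * rnorm x)
  (rnorm z / q)).
- by rewrite divr_ge0 ?rnorm_ge0 // ltW.
- by rewrite ltr_pdivrMr // mul1r.
move=> n; rewrite (iterE (N + n)%N) rnormM rnormX.
have := lN (k + (N + n))%N; rewrite addnCA leq_addr => /(_ isT x).
move/(ler_wpM2l (exprn_ge0 (N + n) (rnorm_ge0 z))) => /le_trans; apply.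
rewrite addnCA addnA [in leLHS](exprD q) [in leLHS](exprD (rnorm z)).
rewrite expr_div_n invfM.
by rewrite le_eqVlt; apply/orP; left; apply/eqP; ring.
Qed.

Lemma resolvent_preserves_perturb z w K :
  resolvent_bound L z K -> K * rnorm (z - w) <= 2^-1 ->
  resolvent_preserves z -> resolvent_preserves w.
Proof.
move=> [K0 zK zS] Kzw zP x xw k k1.
have [S SK] := choice zS.
(* [x] is the fixed point of this contraction, since its argument at [y = x] is
   [shift_operator L z x]. *)
pose T y := S (shift_operator L w x + (z - w) *: y).
have Tx y : rnorm (T y - x) <= 2^-1 * rnorm (y - x).
  rewrite (le_trans (zK _)) // linearB /= SK (shift_operator_perturb _ z w x).
  rewrite opprD addrACA subrr add0r -scalerBr rnormZ mulrA.
  by rewrite ler_wpM2r ?rnorm_ge0.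
(* [N_1] lies in [N_2], so goodness of [z] keeps the orbit of [0] in [N_1]; continuity of [l k] then
   carries the vanishing to the limit [x]. *)
have TP n : annihilated_from 1 (iter n T 0).
  elim: n => [|n IH]; first by move=> j _; rewrite linear0.
  apply: zP; rewrite iterS SK; apply: annihilated_from_add => // j j2.
  by apply: IH; exact: ltnW.
have /bounded_linear_mapP[C C0 lC] := l_bounded k1.
apply: rnorm_eq0.
apply: (@le0_geometric _ _ (C * rnorm (0 - x)) 2^-1) => //.
  by rewrite invf_lt1 // ltr1n.
move=> n; have -> : l k x = - l k (iter n T 0 - x).
  by rewrite linearB /= TP // sub0r opprK.
rewrite rnormN (le_trans (lC _)) // -mulrA ler_pM2l //.
exact: iter_half_contraction.
Qed.

Lemma resolvent_preserves_locally z : resolvent_set L z ->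
  exists2 e : R, 0 < e & forall w, rnorm (z - w) <= e ->
    (resolvent_preserves z <-> resolvent_preserves w).
Proof.
move=> /resolvent_setP[K zK]; have K0 : 0 < K by case: zK.
(* The factor 4 serves the converse direction, where the bound available at [w] is [2 * K]. *)
exists (4 * K)^-1; first by rewrite invr_gt0 mulr_gt0.
move=> w; rewrite invfM ler_pdivlMr // => zw.
have zw2 : K * rnorm (z - w) <= 2^-1.
  by have := rnorm_ge0 (z - w); rewrite mulrC; lra.
split; first exact: (resolvent_preserves_perturb zK zw2).
apply: (resolvent_preserves_perturb (resolvent_bound_perturb zK zw2)).
rewrite -rnormN opprB -mulrA mulrC; lra.
Qed.

Lemma large_resolvent_not_preserves (h0 : B) :
  bounded_linear_map L -> l 1%N h0 = 1 -> annihilated_from 2 h0 ->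
  exists M : R, forall z, M <= rnorm z -> resolvent_set L z ->
    ~ resolvent_preserves z.
Proof.
move=> /bounded_linear_mapP[K K0 LK] lh0 h0_2.
have /bounded_linear_mapP[C C0 lC] := l_bounded (leqnn 1).
(* The first two terms absorb the bounds on [L x] and on [h0]; the final 1 then leaves
   [rnorm x <= 0], against [1 <= C * K * rnorm x]. *)
exists (K + C * K * rnorm h0 + 1) => z Mz /resolvent_setP[k [_ _]].
move=> /(_ h0)[x xh0] zP.
have x1 : l 1%N x = 0 by apply: zP => //; rewrite xh0.
have Lx : l 1%N (L x) = -1.
  by rewrite -lh0 -xh0 linearB linearZ /= x1 scaler0 sub0r opprK.
have h1 : 1 <= C * K * rnorm x.
  have -> : 1 = rnorm (l 1%N (L x)) by rewrite Lx rnormN /rnorm normr1.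
  by rewrite (le_trans (lC _)) // -mulrA ler_pM2l.
have h2 : rnorm z * rnorm x <= rnorm h0 + K * rnorm x.
  rewrite -rnormZ -(subrK (L x) (z *: x)) (le_trans (ler_rnormD _ _)) //.
  by rewrite lerD // -xh0.
have h3 := ler_wpM2r (rnorm_ge0 x) Mz.
have h4 := ler_wpM2r (rnorm_ge0 h0) h1.
have x0 : rnorm x <= 0 by lra.
by have := mulr_ge0_le0 (ltW (mulr_gt0 C0 K0)) x0; lra.
Qed.

End BackwardOrbit.

(** * Dual norms and the root condition (B-1) *)

Section DualNorm.
Context {R : realType} (V : normedModType R[i]) (f : {linear V -> R[i]^o}).
Context (f_bounded : bounded_linear_map f).

(** Boundedness of [f] keeps the [sup] in [dual_norm] from taking its default value. *)
Lemma rnorm_le_dual_norm1 x : `|x| <= 1 -> rnorm (f x) <= dual_norm f.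
Proof.
move=> x1; apply: ub_le_sup; last by exists x.
have /bounded_linear_mapP[K K0 fK] := f_bounded.
exists K => _ [y /= y1 <-]; apply: le_trans (fK y) _.
by rewrite ger_pMr // -lecR -rnormE.
Qed.

Lemma dual_norm_ge0 : 0 <= dual_norm f.
Proof.
have := @rnorm_le_dual_norm1 0.
by rewrite linear0 rnorm0 normr0 ler01 => /(_ isT).
Qed.

Lemma rnorm_le_dual_norm x : rnorm (f x) <= dual_norm f * rnorm x.
Proof.
have [->|x0] := eqVneq x 0; first by rewrite linear0 !rnorm0 mulr0.
have nx0 : 0 < rnorm x.
  by rewrite -ltcR -rnormE normr_gt0.
have := @rnorm_le_dual_norm1 (`|x|^-1 *: x).
rewrite normrZ ger0_norm ?invr_ge0 // mulVf ?normr_eq0 // lexx => /(_ isT).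
rewrite linearZ rnormZ /= rnormE -fmorphV rnorm_real.
by rewrite ger0_norm ?invr_ge0 ?rnorm_ge0 // ler_pdivrMl // mulrC.
Qed.

End DualNorm.

(** As [Lambda^-1 < q^-1], some tail has all its [k]-th roots below [q^-1]; raising to the power [k]
    undoes the root. *)
Lemma limn_esup_dual_norm (R : realType) (V : normedModType R[i])
    (l : nat -> {linear V -> R[i]^o}) (Lambda q : R) :
  (forall k : nat, (1 <= k)%N -> bounded_linear_map (l k)) ->
  (limn_esup (fun k : nat => (dual_norm (l k) `^ (k%:R)^-1)%:E)
     <= (Lambda^-1)%:E)%E ->
  0 < q -> q < Lambda ->
  exists N, forall k, (N <= k)%N -> forall x,
    rnorm (l k x) <= (q ^+ k)^-1 * rnorm x.
Proof.
move=> l_bounded B1 q0 qL.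
have : (limn_esup (fun k : nat => (dual_norm (l k) `^ (k%:R)^-1)%:E)
    < (q^-1)%:E)%E.
  by rewrite (le_lt_trans B1) // lte_fin ltf_pV2 ?posrE // (lt_trans q0).
rewrite /limn_esup /limf_esup => /ereal_inf_lt[_ [A [N _ NA] <-] Aq].
(* The successor forces [k] to be positive, so that [l k] is bounded and [k%:R] is invertible. *)
exists N.+1 => k Nk x.
have k1 : (1 <= k)%N by rewrite (leq_trans _ Nk).
have : ((dual_norm (l k) `^ (k%:R)^-1)%:E < (q^-1)%:E)%E.
  apply: le_lt_trans Aq; apply: ereal_sup_ubound; exists k => //.
  by apply: NA => /=; exact: ltnW.
rewrite lte_fin => /ltW kq.
apply: le_trans (rnorm_le_dual_norm (l_bounded _ k1) x) _.
rewrite ler_wpM2r ?rnorm_ge0 // -exprVn.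
have -> : dual_norm (l k) = (dual_norm (l k) `^ (k%:R)^-1) ^+ k.
  rewrite -powR_mulrn ?powR_ge0 // -powRrM mulVf ?powRr1 ?dual_norm_ge0 //.
    exact: l_bounded.
  by rewrite pnatr_eq0 -lt0n.
by rewrite lerXn2r // nnegrE ?powR_ge0 // invr_ge0 ltW.
Qed.

(** * Propagation of goodness along a segment *)

(** Connectedness of the segment: [P] passes to the supremum of the points where it holds, and from
    there further right unless that supremum is [b]. *)
Lemma segment_locally_constant (R : realType) (P : R -> Prop) (a b : R) :
  a <= b ->
  (forall t, a <= t <= b -> exists2 e, 0 < e & forall u, a <= u <= b ->
    `|t - u| <= e -> (P t <-> P u)) ->
  P a -> P b.
Proof.
move=> ab locP Pa.
pose T := [set t | a <= t <= b /\ P t].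
have Ta : T a by split; rewrite ?lexx.
have Tsup : has_sup T by split; [exists a | exists b => t [/andP[]]].
have as_ : a <= sup T by apply: ub_le_sup => //; case: Tsup.
have sb : sup T <= b by apply: ge_sup; [exists a | move=> t [/andP[]]].
have [|e e0 Pe] := locP (sup T); first by rewrite as_.
have [t [/andP[ta tb] Pt] st] := sup_adherent e0 Tsup.
have ts : t <= sup T by apply: ub_le_sup; [case: Tsup | split; rewrite ?ta].
have Ps : P (sup T).
  by apply/(Pe t) => //; [rewrite ta | rewrite ger0_norm; lra].
have [sb'|bs] := ltP (sup T) b; last by have <- : sup T = b by lra.
pose u := Num.min b (sup T + e).
have su : sup T < u by rewrite lt_min sb' ltrDl.
have ub : u <= b by rewrite ge_min lexx.
have us : u <= sup T + e by rewrite ge_min lexx orbT.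
suff /(ub_le_sup Tsup.2) : T u by rewrite leNgt su.
split; first by rewrite ub andbT; lra.
apply/(Pe u) => //; first by rewrite ub andbT; lra.
by rewrite ler0_norm; lra.
Qed.

Lemma rnorm_complex_le (R : realType) (a b : R) :
  rnorm (Complex a b) <= `|a| + `|b|.
Proof.
have -> : Complex a b = real_complex R a + real_complex R b * Complex 0 1.
  by apply/eqP; rewrite eq_complex /=; apply/andP; split; apply/eqP; ring.
rewrite (le_trans (ler_rnormD _ _)) // rnormM !rnorm_real.
suff -> : rnorm (Complex 0 1 : R[i]) = 1 by rewrite mulr1.
by rewrite /rnorm normc_def /= expr0n expr1n add0r sqrtr1.
Qed.

Lemma ler_Re_rnorm (R : realType) (z : R[i]) : complex.Re z <= rnorm z.
Proof.
rewrite /rnorm normc_def /= (le_trans (ler_norm _)) // -sqrtr_sqr ler_wsqrtr //.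
by rewrite lerDl sqr_ge0.
Qed.

(** On a segment inside the resolvent set, goodness would pass from one end to the other. The
    condition at [b] is conditional because [large_resolvent_not_preserves] speaks of resolvent
    points only. *)
Lemma segment_meets_spectrum (R : realType) (B : completeNormedModType R[i])
    (L : {linear B -> B}) (l : nat -> {linear B -> R[i]^o}) (a b s : R) :
  (forall k : nat, (1 <= k)%N -> bounded_linear_map (l k)) ->
  a <= b ->
  resolvent_preserves L l (Complex a s) ->
  (resolvent_set L (Complex b s) -> ~ resolvent_preserves L l (Complex b s)) ->
  exists2 t, a <= t <= b & spectrum L (Complex t s).
Proof.
move=> l_bounded ab Pa Pb; apply: contrapT => noz.
have res t : a <= t <= b -> resolvent_set L (Complex t s).
  by move=> tab; apply: contrapT => zt; apply: noz; exists t.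
apply: Pb; first by apply: res; rewrite ab lexx.
pose P t := resolvent_preserves L l (Complex t s).
apply: (segment_locally_constant (P := P) ab) => // t tab.
have [e e0 eP] := resolvent_preserves_locally l_bounded (res _ tab).
exists e => // u _ tu; apply: eP; apply: le_trans tu.
have -> : Complex t s - Complex u s = real_complex R (t - u).
  by apply/eqP; rewrite eq_complex /= subrr !eqxx.
by rewrite rnorm_real.
Qed.

(** * Accumulation of the spectrum at a real point *)

Theorem proposition2p2 (R : realType) (B : completeNormedModType R[i])
    (L : {linear B -> B}) (L_bounded : bounded_linear_map L)
    (h0 : B) (Lambda : R) (Lambda_gt0 : 0 < Lambda)
    (l : nat -> {linear B -> R[i]^o})
    (l_bounded : forall k : nat, (1 <= k)%N -> bounded_linear_map (l k))
    (B1 : (limn_esup (fun k : nat => (dual_norm (l k) `^ (k%:R)^-1)%:E)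
             <= (Lambda^-1)%:E)%E)
    (B2a : l 1%N h0 = 1)
    (B2b : forall k : nat, (1 <= k)%N -> l k.+1 h0 = 0)
    (B3 : forall k : nat, (1 <= k)%N -> dual_operator L (l k.+1) =1 l k) :
  (Lambda%:E <= essential_spectral_radius L)%E.
Proof.
suff ess r : 0 < r -> r < Lambda ->
    exists2 z, essential_spectrum L z & r <= rnorm z.
  apply/lee_subgt0Pr => e e0.
  (* The maximum with [Lambda / 2] keeps the radius positive when [e] exceeds [Lambda]. *)
  have m0 : 0 < Num.max (Lambda / 2) (Lambda - e) by rewrite lt_max divr_gt0.
  have [|z zL rz] := ess _ m0; first by rewrite gt_max; apply/andP; split; lra.
  apply: (@le_trans _ _ (rnorm z)%:E); last first.
    by apply: ereal_sup_ubound; exists z.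
  by rewrite -EFinB lee_fin (le_trans _ rz) // le_max lexx orbT.
move=> r0 rL.
have h0_2 : annihilated_from l 2 h0 by case=> // k k1; exact: B2b.
have [M MP] := large_resolvent_not_preserves l_bounded L_bounded B2a h0_2.
(* For heights in []0, d]] the left end of the segment has modulus at most [r + d < q < Lambda],
   hence is good. *)
pose q := (r + Lambda) / 2.
pose d := (q - r) / 2.
have d0 : 0 < d by rewrite /d /q; lra.
have lq := @limn_esup_dual_norm _ _ _ _ q l_bounded B1.
(* Positive heights keep the spectral points off the real line, hence distinct
   from their real limit p. *)
pose s n : R := d / n.+1%:R.
have s0 n : 0 < s n by rewrite divr_gt0.
have sd n : s n <= d by rewrite ler_pdivrMr // ler_pMr // ler1n.
have meets n : exists t, r <= t <= Num.max r M /\ spectrum L (Complex t (s n)).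
  have [|||t tr tL] := @segment_meets_spectrum _ _ L l r (Num.max r M) (s n)
    l_bounded.
  - by rewrite le_max lexx.
  - have q0 : 0 < q by rewrite /q; lra.
    have qL : q < Lambda by rewrite /q; lra.
    apply: (small_resolvent_preserves B3 q0 _ (lq q0 qL)).
    rewrite (le_lt_trans (rnorm_complex_le _ _)) // !gtr0_norm //.
    by have := sd n; rewrite /d /q in d0 *; lra.
  - apply: MP; rewrite (le_trans _ (ler_Re_rnorm _)) //=.
    by rewrite le_max lexx orbT.
  by exists t.
have [t /all_and2[tr tL]] := choice meets.
(* The abscissae stay in a compact interval, so they cluster at some [p >= r]. *)
have [p [pr pt]] : `[r, Num.max r M] `&` cluster (t @ \oo) !=set0.
  apply: (@segment_compact _ r (Num.max r M)).
  by exists 0%N => // n _; rewrite /= in_itv /=.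
have near_p e : 0 < e -> exists2 w, w != Complex p 0 &
    spectrum L w /\ rnorm (Complex p 0 - w) < e.
  (* Half of [e] is for the abscissa; the other half bounds the height [d / n.+1%:R], whence the
     threshold [e / 2 / d]. *)
  move=> e0; have e2d : 0 < e / 2 / d by rewrite divr_gt0 // divr_gt0.
  have [N _ Ns] := near_infty_natSinv_lt (PosNum e2d).
  have [|_ [[n Nn <-] ptn]] := pt [set t n | n in [set n | (N <= n)%N]]
    (ball p (e / 2)) _ (nbhsx_ballx _ _ (divr_gt0 e0 (ltr0n _ 2))).
    by exists N => // n /= Nn; exists n.
  exists (Complex (t n) (s n)).
    by rewrite eq_complex negb_and /= (gt_eqF (s0 n)) orbT.
  split=> //.
  have -> : Complex p 0 - Complex (t n) (s n) = Complex (p - t n) (- s n).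
    by apply/eqP; rewrite eq_complex /= sub0r !eqxx.
  rewrite (le_lt_trans (rnorm_complex_le _ _)) // [ltRHS]splitr ltrD //.
  by rewrite normrN gtr0_norm // /s mulrC -ltr_pdivlMr // Ns.
(* The spectrum is closed: a resolvent neighbourhood of [p] would contain one of the nearby spectral
   points. *)
have Lp : spectrum L (Complex p 0).
  move=> /resolvent_setP[K pK]; have K0 : 0 < K by case: pK.
  have [|w _ [wL /ltW pw]] := near_p (2 * K)^-1.
    by rewrite invr_gt0 mulr_gt0.
  by apply: wL; exact: resolvent_set_nbhs pK _ pw.
exists (Complex p 0); last first.
  move: pr; rewrite /= in_itv /= => /andP[rp _].
  by rewrite (le_trans rp) // (le_trans _ (ler_Re_rnorm _)).
split=> //; right; right => U /nbhs_ballP[e /= e0 eU].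
have eE : e = real_complex R (complex.Re e) by rewrite RRe_real // gtr0_real.
have e0' : 0 < complex.Re e by rewrite -ltcR -eE.
have [w wp [wL pw]] := near_p _ e0'.
exists w; split=> //; apply: eU.
by rewrite -ball_normE /= rnormE eE ltcR.
Qed.
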